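(* $$F_{123}(x,y)=F_{321}(x,y)=\frac{1+xy-x-\sqrt{1-2x-3x^2-xy(2-2x-xy)}}{2x(x+y-xy)}.$$
   Context: The patterns $123$ and $321$ are written without dashes, so an occurrence of $123$ (resp. $321$) in $\pi=\pi_1\cdots\pi_n\in S_n$ is a position $i$ with $\pi_i<\pi_{i+1}<\pi_{i+2}$ (resp. $\pi_i>\pi_{i+1}>\pi_{i+2}$). A permutation is $1\text{-}3\text{-}2$-avoiding if there are no positions $a<b<c$ with $\pi_a<\pi_c<\pi_b$. $f_{\tau;r}(n)$ is the number of $1\text{-}3\text{-}2$-avoiding permutations in $S_n$ containing exactly $r$ occurrences of $\tau$ (with $S_0$ consisting of the empty permutation), and $F_\tau(x,y)=\sum_{n,r\ge 0} f_{\tau;r}(n)x^ny^r$, a formal power series in $x$ with coefficients in $\mathbb Z[y]$. The square root denotes the formal power series in $x$ with constant term $1$. *)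

(* Defs.v *)
From HB Require Import structures.
From mathcomp Require Import all_boot all_order all_algebra all_fingroup.
From mathcomp Require Import boolp.

Set Implicit Arguments.
Unset Strict Implicit.
Unset Printing Implicit Defensive.

Import Order.TTheory GRing.Theory Num.Theory.
Local Open Scope ring_scope.

(* Formal power series in one variable.  A record is used rather than an alias
   of [nat -> R], so that the Cauchy product below cannot be confused with the
   pointwise product of functions. *)
Record fps (R : Type) := Fps { fps_coef : nat -> R }.

Lemma fpsP (R : Type) (f g : fps R) : fps_coef f =1 fps_coef g <-> f = g.
Proof.
split=> [|-> //]; case: f g => f [g] /= fg.
by congr Fps; apply/funext.
Qed.

HB.instance Definition _ (R : Type) := gen_eqMixin (fps R).
HB.instance Definition _ (R : Type) := gen_choiceMixin (fps R).

Section FpsZmodule.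
Variable R : zmodType.
Implicit Types f g h : fps R.

Definition fps_zero : fps R := Fps (fun=> 0).
Definition fps_opp f := Fps (fun n => - fps_coef f n).
Definition fps_add f g := Fps (fun n => fps_coef f n + fps_coef g n).

Fact fps_addA : associative fps_add.
Proof. by move=> f g h; apply/fpsP => n /=; rewrite addrA. Qed.
Fact fps_addC : commutative fps_add.
Proof. by move=> f g; apply/fpsP => n /=; rewrite addrC. Qed.
Fact fps_add0 : left_id fps_zero fps_add.
Proof. by move=> f; apply/fpsP => n /=; rewrite add0r. Qed.
Fact fps_addN : left_inverse fps_zero fps_opp fps_add.
Proof. by move=> f; apply/fpsP => n /=; rewrite addNr. Qed.

HB.instance Definition _ :=
  GRing.isZmodule.Build (fps R) fps_addA fps_addC fps_add0 fps_addN.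

End FpsZmodule.

Section FpsRing.
Variable R : comNzRingType.
Implicit Types f g h : fps R.

Definition fpsC (c : R) : fps R := Fps (fun n => if n == 0%N then c else 0).
Definition fpsX : fps R := Fps (fun n => (n == 1%N)%:R).
Definition fps_mul f g : fps R :=
  Fps (fun n => \sum_(i < n.+1) fps_coef f i * fps_coef g (n - i)).

Definition fps_trunc m f : {poly R} := \poly_(i < m) fps_coef f i.

Lemma coef_fps_mul_trunc m n f g : (n < m)%N ->
  fps_coef (fps_mul f g) n = (fps_trunc m f * fps_trunc m g)`_n.
Proof.
move=> nm; rewrite coefM; apply: eq_bigr => i _.
rewrite !coef_poly (leq_ltn_trans (leq_subr i n) nm).
by rewrite (leq_ltn_trans _ nm) // -ltnS.
Qed.

Fact fps_mulC : commutative fps_mul.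
Proof.
by move=> f g; apply/fpsP => n; rewrite !(coef_fps_mul_trunc _ _ (ltnSn n)) mulrC.
Qed.

Fact fps_mulA : associative fps_mul.
Proof.
move=> f g h; apply/fpsP => n; pose T := fps_trunc n.+1.
have le_n (i : 'I_n.+1) : (i < n.+1)%N := ltn_ord i.
transitivity (T f * (T g * T h))`_n.
  rewrite coefM; apply: eq_bigr => i _; rewrite coef_poly le_n.
  by rewrite (@coef_fps_mul_trunc n.+1) // ltnS leq_subr.
rewrite mulrA coefM; apply: eq_bigr => i _.
rewrite [(T h)`_ _]coef_poly ltnS leq_subr.
by rewrite (@coef_fps_mul_trunc n.+1).
Qed.

Fact fps_mul1 : left_id (fpsC 1) fps_mul.
Proof.
move=> f; apply/fpsP => n /=.
by rewrite big_ord_recl /= mul1r subn0 big1 ?addr0 // => i _; rewrite mul0r.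
Qed.

Fact fps_mulDl : left_distributive fps_mul +%R.
Proof.
move=> f g h; apply/fpsP => n /=; rewrite -big_split /=.
by apply: eq_bigr => i _; rewrite mulrDl.
Qed.

Fact fps_1neq0 : fpsC 1 != 0.
Proof.
by apply/eqP => /fpsP/(_ 0%N) /= /eqP; rewrite oner_eq0.
Qed.

HB.instance Definition _ := GRing.Zmodule_isComNzRing.Build (fps R)
  fps_mulA fps_mulC fps_mul1 fps_mulDl fps_1neq0.

Definition fps_unit : {pred fps R} := fun f => `[< exists g, g * f = 1 >].
Definition fps_inv f : fps R :=
  if pselect (exists g, g * f = 1) is left e then projT1 (cid e) else f.

Fact fps_mulVx : {in fps_unit, left_inverse 1 fps_inv *%R}.
Proof.
move=> f /asboolP fU; rewrite /fps_inv; case: pselect => // e.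
by case: (cid e).
Qed.

Fact fps_unitPl f g : g * f = 1 -> fps_unit f.
Proof. by move=> gf; apply/asboolP; exists g. Qed.

Fact fps_inv_out : {in [predC fps_unit], fps_inv =1 id}.
Proof.
by move=> f /asboolPn fNU; rewrite /fps_inv; case: pselect.
Qed.

HB.instance Definition _ := GRing.ComNzRing_hasMulInverse.Build (fps R)
  fps_mulVx fps_unitPl fps_inv_out.

End FpsRing.

Section FpsIdomain.
Variable R : idomainType.
Implicit Types f g : fps R.

Lemma fps_neq0 f : f != 0 ->
  exists2 m, fps_coef f m != 0 & forall i, (i < m)%N -> fps_coef f i = 0.
Proof.
move=> f0; have ex : exists n, fps_coef f n != 0.
  apply: contrapT => no; move/eqP: f0; apply; apply/fpsP => n /=.
  by case: (eqVneq (fps_coef f n) 0) => // nz; case: no; exists n.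
case: (ex_minnP ex) => m fm min; exists m => // i im.
by apply/eqP; apply: contraTT im => /min; rewrite -leqNgt.
Qed.

Fact fps_integral f g : f * g = 0 -> (f == 0) || (g == 0).
Proof.
move=> fg0; apply/norP => -[/fps_neq0[m fm fl] /fps_neq0[k gk gl]].
have /fpsP/(_ (m + k)%N) /= := fg0.
have mI : (m < (m + k).+1)%N by rewrite ltnS leq_addr.
rewrite (bigD1 (Ordinal mI)) //= addKn big1 ?addr0; last first.
  move=> i; rewrite -val_eqE /= neq_ltn => /orP[im|mi].
    by rewrite fl // mul0r.
  rewrite (gl (m + k - i)%N) ?mulr0 //.
  by rewrite ltn_subLR ?ltn_add2r // -ltnS.
by move/eqP; rewrite mulf_eq0 (negPf fm) (negPf gk).
Qed.

HB.instance Definition _ :=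
  GRing.ComUnitRing_isIntegral.Build (fps R) fps_integral.

End FpsIdomain.

(* The embedding of a domain in its field of fractions; the library reserves
   this notation but only declares it locally. *)
Notation "x %:F" := (@FracField.tofrac _ x) : ring_scope.

(* [S] is the square root of [D] with constant term 1. *)
Definition is_fps_sqrt (R : comNzRingType) (D S : fps R) : Prop :=
  fps_coef S 0 = 1 /\ S ^+ 2 = D.

Lemma is_fps_sqrt_uniq (R : idomainType) (D S T : fps R) :
  (2 : R) != 0 -> is_fps_sqrt D S -> is_fps_sqrt D T -> S = T.
Proof.
move=> n2 [S0 S2] [T0 T2].
have /eqP : S ^+ 2 = T ^+ 2 by rewrite S2 T2.
rewrite eqf_sqr => /orP[/eqP //|/eqP /fpsP/(_ 0%N) /=].
rewrite S0 T0 => /eqP; rewrite -subr_eq0 opprK => e.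
by rewrite e in n2.
Qed.

(* Permutations are read in one-line notation, [s : 'S_n] being the word
   [s 0, ..., s (n - 1)] on the letters [0, ..., n - 1]. *)

Definition avoids132 n (s : 'S_n) : bool :=
  ~~ [exists a : 'I_n, exists b : 'I_n, exists c : 'I_n,
        [&& (a < b)%N, (b < c)%N, (s a < s c)%N & (s c < s b)%N]].

(* A consecutive pattern of length 3, as the condition it imposes on three
   adjacent letters. *)
Definition pattern3 := nat -> nat -> nat -> bool.
Definition pat123 : pattern3 := fun u v w => (u < v < w)%N.
Definition pat321 : pattern3 := fun u v w => (w < v < u)%N.

Definition occurs_at (tau : pattern3) n (s : 'S_n) (i : 'I_n) : bool :=
  [exists j : 'I_n, exists k : 'I_n,
     [&& j == i.+1 :> nat, k == i.+2 :> nat & tau (s i) (s j) (s k)]].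

Definition occ (tau : pattern3) n (s : 'S_n) : nat :=
  #|[set i | occurs_at tau s i]|.

Definition f_ (tau : pattern3) (r n : nat) : nat :=
  #|[set s : 'S_n | avoids132 s & occ tau s == r]|.

Lemma f_eq0 tau r n : (n < r)%N -> f_ tau r n = 0%N.
Proof.
move=> nr; apply: eq_card0 => s; rewrite inE.
apply/negP => /andP[_ /eqP sr]; move: nr; rewrite -sr ltnNge.
by rewrite (leq_trans (max_card _)) // card_ord.
Qed.

(* F_tau(x, y), a power series in x over Z[y].  Cutting off the sum over r at
   n loses nothing, by [f_eq0]; see [coef_F_]. *)
Definition F_ (tau : pattern3) : fps {poly int} :=
  Fps (fun n => \poly_(r < n.+1) (f_ tau r n)%:Z).

Lemma coef_F_ tau n r : (fps_coef (F_ tau) n)`_r = (f_ tau r n)%:Z.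
Proof. by rewrite coef_poly ltnS; case: leqP => // /f_eq0 ->. Qed.

(* Main.v *)
Require Import Defs.
From mathcomp Require Import all_boot all_order all_algebra all_fingroup.
From mathcomp Require Import zify ring.
Import GRing.Theory.
Local Open Scope ring_scope.

(** A 1-3-2-avoiding permutation is (s + |t|) n t with s and t avoiding, so the
words factor uniquely at their maximum.  A consecutive 123 is created at that
factorization exactly when s ends with an ascent, and a 321 exactly when t
begins with a descent.  With A the generating function of the words carrying
this mark and G = F + (y - 1) A, both patterns lead to the same system
F = 1 + x G F and A = x (G A + G - 1).  Eliminating A gives
x (x + y - x y) F^2 = (1 + x y - x) F - 1, whose discriminant is the radicand;
hence 1 + x y - x - 2 x (x + y - x y) F is its square root with constant
term 1, and uniqueness of that root makes the two F equal. *)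

Set Implicit Arguments.
Unset Strict Implicit.
Unset Printing Implicit Defensive.

(** * Avoiding words and their factorization at the maximum *)

Fixpoint av132 (w : seq nat) : bool :=
  if w is x :: w' then
    pairwise (fun b c => ~~ (x < c < b)%N) w' && av132 w'
  else true.

Fixpoint occw (tau : pattern3) (w : seq nat) : nat :=
  if w is u :: w' then
    ((if w' is v :: z :: _ then tau u v z else false) + occw tau w')%N
  else 0%N.

Fixpoint ends_asc (w : seq nat) : bool :=
  if w is u :: w' then if w' is [:: v] then (u < v)%N else ends_asc w'
  else false.

Definition begins_desc (w : seq nat) : bool :=
  if w is u :: v :: _ then (v < u)%N else false.

(** Letters start at 0, so shifting [s] by [size t] places it just above [t], and [size s + size t]
    is the new maximum. *)
Definition glue (s t : seq nat) : seq nat :=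
  map (addn (size t)) s ++ (size s + size t)%N :: t.

Definition av_words (n : nat) : seq (seq nat) :=
  [seq w <- permutations (iota 0 n) | av132 w].

Lemma perm_eq_iotaP n (w : seq nat) :
  reflect [/\ uniq w, size w = n & forall x, x \in w -> (x < n)%N]
          (perm_eq w (iota 0 n)).
Proof.
apply: (iffP idP) => [pw|[uw sw bw]].
  split; first by rewrite (perm_uniq pw) iota_uniq.
    by rewrite (perm_size pw) size_iota.
  by move=> x; rewrite (perm_mem pw) mem_iota.
have sub : {subset w <= iota 0 n} by move=> x /bw; rewrite mem_iota.
have [|_ e] := uniq_min_size uw sub; first by rewrite size_iota sw.
by apply: uniq_perm => //; apply: iota_uniq.
Qed.

Lemma mem_av_words n w :
  (w \in av_words n) = av132 w && perm_eq w (iota 0 n).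
Proof. by rewrite mem_filter mem_permutations. Qed.

Lemma av132_addn k w : av132 (map (addn k) w) = av132 w.
Proof.
elim: w => //= x w ->; rewrite pairwise_map; congr (_ && _).
by apply: eq_pairwise => b c /=; rewrite !ltn_add2l.
Qed.

Lemma pairwise_in_right (T : eqType) (r : rel T) (t : seq T) :
  {in t, forall c b, r b c} -> pairwise r t.
Proof.
elim: t => //= x t IH rt; rewrite IH ?andbT; last first.
  by move=> c ct b; apply: rt; rewrite inE ct orbT.
by apply/allP => c ct; apply: rt; rewrite inE ct orbT.
Qed.

(** No 1-3-2 meets two of the parts: a 1 taken in [s] exceeds all of [t], and [m] can serve neither
    as the 2 nor as the 1, so the 2, hence the 3, also lies in [s]. *)
Lemma av132_cat_max (s : seq nat) m (t : seq nat) :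
  (forall x, x \in s -> (x < m)%N) -> (forall x, x \in t -> (x < m)%N) ->
  allrel (fun x y => y < x)%N s t ->
  av132 (s ++ m :: t) = av132 s && av132 t.
Proof.
move=> sm tm; elim: s sm => [_ _|x s IH sm] /=.
  case: (av132 t); rewrite ?andbF //= andbT.
  by apply: pairwise_in_right => c /tm cm b; lia.
rewrite allrel_consl => /andP[/allP xt st].
rewrite IH //; last by move=> y ys; apply: sm; rewrite inE ys orbT.
rewrite -andbA; congr (_ && _); rewrite pairwise_cat /=.
have -> : allrel (fun b c => ~~ (x < c < b)%N) s (m :: t).
  apply/allrelP => b c bs; rewrite inE => /orP[/eqP->|/xt].
    have : (b < m)%N by apply: sm; rewrite inE bs orbT.
    lia.
  lia.
have -> : all (fun c => ~~ (x < c < m)%N) t by apply/allP => c /xt; lia.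
suff -> : pairwise (fun b c => ~~ (x < c < b)%N) t by rewrite /= andbT.
by apply: pairwise_in_right => c /xt /= cx b; lia.
Qed.

(** A letter [x] of [s] below a letter [c] of [t] would make [x], [m], [c] a 1-3-2. *)
Lemma av132_cat_gtn (s : seq nat) m (t : seq nat) : uniq (s ++ m :: t) ->
  (forall x, x \in t -> (x < m)%N) ->
  av132 (s ++ m :: t) -> allrel (fun x y => y < x)%N s t.
Proof.
move=> us tm; elim: s us => //= x s IH /andP[xn us] /andP[pw av].
rewrite allrel_consl IH // andbT; apply/allP => c ct.
have := tm _ ct; move: pw; rewrite pairwise_cat /= => /and4P[_ _ /allP/(_ c ct) /= xcm _].
have : x != c.
  by apply: contraNneq xn => ->; rewrite mem_cat inE ct !orbT.
lia.
Qed.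

Lemma glue_av_words k l s t : s \in av_words k -> t \in av_words l ->
  glue s t \in av_words (k + l).+1.
Proof.
rewrite !mem_av_words => /andP[avs /perm_eq_iotaP[us ss bs]].
move=> /andP[avt /perm_eq_iotaP[ut st bt]].
have bs' x : x \in map (addn l) s -> (l <= x < k + l)%N.
  by case/mapP => y /bs yk ->; lia.
rewrite /glue ss st av132_cat_max; first last.
- by apply/allrelP => x y /bs' xl /bt; lia.
- by move=> x /bt; lia.
- by move=> x /bs'; lia.
rewrite av132_addn avs avt !andTb; apply/perm_eq_iotaP; split.
- rewrite cat_uniq (map_inj_uniq (@addnI l)) us /= ut andbT negb_or -andbA.
  apply/and3P; split.
  + by apply/negP => /bs'; lia.
  + by apply/hasPn => x /bt xl; apply/negP => /bs'; lia.
  + by apply/negP => /bt; lia.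
- by rewrite size_cat size_map /= ss st addnS.
- by move=> x; rewrite mem_cat inE => /or3P[/bs'|/eqP->|/bt]; lia.
Qed.

Lemma av_words_split n w : w \in av_words n.+1 ->
  exists k s t, [/\ (k <= n)%N, s \in av_words k, t \in av_words (n - k)
                  & w = glue s t].
Proof.
rewrite mem_av_words => /andP[avw pw].
have nw : n \in w by rewrite (perm_mem pw) mem_iota leqnn.
case/splitPr: nw pw avw => s t /perm_eq_iotaP[uw sw bw] avw.
have mem x : (x \in s ++ n :: t) = (x < n.+1)%N.
  have /perm_eq_iotaP/perm_mem -> : [/\ uniq (s ++ n :: t),
      size (s ++ n :: t) = n.+1 & forall x, x \in s ++ n :: t -> (x < n.+1)%N].
    by split.
  by rewrite mem_iota.
move: (uw); rewrite cat_uniq /= negb_or.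
case/and3P => us /andP[nns nst] /andP[nnt ut].
have tn x : x \in t -> (x < n)%N.
  move=> xt; have := bw x; rewrite mem_cat inE xt !orbT => /(_ isT).
  by rewrite ltnS leq_eqVlt => /orP[/eqP xn|//]; rewrite -xn xt in nnt.
have sn x : x \in s -> (x < n)%N.
  move=> xs; have := bw x; rewrite mem_cat xs => /(_ isT).
  by rewrite ltnS leq_eqVlt => /orP[/eqP xn|//]; rewrite -xn xs in nns.
have st := av132_cat_gtn uw tn avw.
move: avw; rewrite (av132_cat_max sn tn st) => /andP[avs avt].
(* Every letter below [c] lies in [t], since those of [s] exceed [c]; thus [t] contains the [c.+1]
   letters [0, ..., c]. *)
have bt c : c \in t -> (c < size t)%N.
  move=> ct; rewrite -(size_iota 0 c.+1); apply: uniq_leq_size.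
    exact: iota_uniq.
  move=> v; rewrite mem_iota /= add0n ltnS leq_eqVlt => /orP[/eqP->//|vc].
  have := mem v; rewrite mem_cat inE.
  case vs: (v \in s); first by have := allrelP st v c vs ct; lia.
  have := tn _ ct; case: (v \in t) => //.
  case: eqP => /=; lia.
have pt : perm_eq t (iota 0 (size t)) by apply/perm_eq_iotaP.
have bs x : x \in s -> (size t <= x)%N.
  move=> xs; rewrite leqNgt; apply/negP => xt.
  have: x \in t by rewrite (perm_mem pt) mem_iota.
  by move=> /(hasPn nst); rewrite /= xs.
have sz : n = (size s + size t)%N.
  by move: sw; rewrite size_cat /= addnS => -[].
(* By [bs], the truncated subtraction loses nothing. *)
have es : s = map (addn (size t)) (map (subn^~ (size t)) s).
  rewrite -map_comp -[LHS]map_id; apply/eq_in_map => x /bs /= xs; lia.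
exists (size s), (map (subn^~ (size t)) s), t; split.
- lia.
- rewrite mem_av_words -(av132_addn (size t)) -es avs /=.
  apply/perm_eq_iotaP; split; last 1 first.
  + by move=> x /mapP[y ys ->]; rewrite ltn_subLR ?bs // addnC -sz sn.
  + by rewrite -(map_inj_uniq (@addnI (size t))) -es.
  + by rewrite size_map.
- by rewrite mem_av_words avt sz addKn.
- by rewrite /glue -es size_map sz.
Qed.

Lemma size_av_words n w : w \in av_words n -> size w = n.
Proof. by rewrite mem_av_words => /andP[_ /perm_eq_iotaP[]]. Qed.

Lemma av_words_bound n w :
  w \in av_words n -> {in w, forall x, (x < size w)%N}.
Proof. by rewrite mem_av_words => /andP[_ /perm_eq_iotaP[_ -> ?]]. Qed.

Lemma index_glue s t : {in s, forall x, (x < size s)%N} ->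
  index (size s + size t)%N (glue s t) = size s.
Proof.
move=> bs; rewrite /glue index_cat ifN; last first.
  by apply/negP => /mapP[x /bs]; lia.
by rewrite /= eqxx addn0 size_map.
Qed.

(** The position of the maximum recovers the length of the first factor, and hence the place to
    cut. *)
Lemma glue_inj s t s' t' :
  {in s, forall x, (x < size s)%N} -> {in s', forall x, (x < size s')%N} ->
  glue s t = glue s' t' -> s = s' /\ t = t'.
Proof.
move=> bs bs' e; have ss : size s = size s'.
  rewrite -(index_glue t bs) -(index_glue t' bs') e; congr index.
  have := congr1 size e; rewrite !size_cat !size_map /=; lia.
move/eqP: e; rewrite eqseq_cat ?size_map //.
case/andP => /eqP es /eqP[_ et]; split=> //.
by move: es; rewrite et => /inj_map -> //; apply: addnI.
Qed.

Lemma av_wordsS n : perm_eq (av_words n.+1)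
  (flatten [seq [seq glue s t | s <- av_words k, t <- av_words (n - k)]
           | k <- iota 0 n.+1]).
Proof.
apply: uniq_perm.
- by rewrite filter_uniq // permutations_uniq.
- have uav m : uniq (av_words m) by rewrite filter_uniq ?permutations_uniq.
  (* Regrouping [s] and [t] as one pair reduces the absence of duplicates to injectivity in [k] and
     the pair; [k] is recovered as the size of [s]. *)
  have -> : flatten [seq [seq glue s t | s <- av_words k, t <- av_words (n - k)]
           | k <- iota 0 n.+1] =
    [seq glue p.1 p.2 | k <- iota 0 n.+1,
      p <- [seq (s, t) | s <- av_words k, t <- av_words (n - k)]].
    congr flatten; apply: eq_map => k.
    by rewrite map_allpairs.
  apply: allpairs_uniq_dep.
  + exact: iota_uniq.
  + by move=> k _; apply: allpairs_uniq => // -[? ?] [? ?].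
  move=> _ _ /allpairsPdep[k [p [_ kp ->]]] /allpairsPdep[k' [p' [_ kp' ->]]].
  case/allpairsP: kp => -[s t] /= [sk tk ->].
  case/allpairsP: kp' => -[s' t'] /= [sk' tk' ->] /= e.
  have [es et] := glue_inj (av_words_bound sk) (av_words_bound sk') e.
  by rewrite -(size_av_words sk) -(size_av_words sk') es et.
- move=> w; apply/idP/flatten_mapP => [/av_words_split[k [s [t [kn sk tk ->]]]]|].
    by exists k; [rewrite mem_iota | apply/allpairsP; exists (s, t)].
  case=> k; rewrite mem_iota => /= kn /allpairsP[[s t] /= [sk tk ->]].
  by have := glue_av_words sk tk; rewrite subnKC.
Qed.

(** * Occurrences and marks under gluing *)

Lemma occw_addn (tau : pattern3) k w :
  (forall a b c, tau (k + a)%N (k + b)%N (k + c)%N = tau a b c) ->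
  occw tau (map (addn k) w) = occw tau w.
Proof. by move=> tk; elim: w => //= u [|v [|z w]] //= ->; rewrite tk. Qed.

Lemma ends_asc_addn k w : ends_asc (map (addn k) w) = ends_asc w.
Proof. by elim: w => //= u [|v [|z w]] //=; rewrite ltn_add2l. Qed.

Lemma begins_desc_addn k w : begins_desc (map (addn k) w) = begins_desc w.
Proof. by case: w => [|u [|v w]] //=; rewrite ltn_add2l. Qed.

(** Among the windows of three letters through [m], only the one ending at [m] can increase, and it
    does exactly when [s] ends with an ascent. *)
Lemma occ123_cat_max s m t :
  {in s, forall x, (x < m)%N} -> {in t, forall x, (x < m)%N} ->
  occw pat123 (s ++ m :: t) = (occw pat123 s + occw pat123 t + ends_asc s)%N.
Proof.
move=> sm tm; elim: s sm => [_|u [|v [|z s]] IH sm].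
- case: t tm => [|a [|b t]] //= tm.
  have := tm a (mem_head _ _); rewrite /pat123; lia.
- have := IH (fun x => ltac:(done)); rewrite /= => ->.
  case: t tm {IH} => [|a t] //= tm.
  by have := tm a (mem_head _ _); rewrite /pat123; lia.
- have -> : occw pat123 ([:: u; v] ++ m :: t) =
      (pat123 u v m + occw pat123 ([:: v] ++ m :: t))%N by [].
  rewrite IH; last by move=> x xs; apply: sm; rewrite inE xs orbT.
  have := sm v; rewrite !inE eqxx orbT => /(_ isT).
  rewrite /= /pat123; lia.
have -> : occw pat123 ([:: u, v, z & s] ++ m :: t) =
    (pat123 u v z + occw pat123 ([:: v, z & s] ++ m :: t))%N by [].
rewrite IH; last by move=> x xs; apply: sm; rewrite inE xs orbT.
by rewrite /=; lia.
Qed.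

(** Here only the window starting at [m] can decrease. *)
Lemma occ321_cat_max s m t :
  {in s, forall x, (x < m)%N} -> {in t, forall x, (x < m)%N} ->
  occw pat321 (s ++ m :: t) = (occw pat321 s + occw pat321 t + begins_desc t)%N.
Proof.
move=> sm tm; elim: s sm => [_|u [|v [|z s]] IH sm].
- case: t tm => [|a [|b t]] //= tm.
  have := tm a (mem_head _ _); rewrite /pat321; lia.
- have := IH (fun x => ltac:(done)); rewrite /= => ->.
  have := sm u (mem_head _ _).
  by case: t tm {IH} => [|a t] //= tm; rewrite /pat321; lia.
- have -> : occw pat321 ([:: u; v] ++ m :: t) =
      (pat321 u v m + occw pat321 ([:: v] ++ m :: t))%N by [].
  rewrite IH; last by move=> x xs; apply: sm; rewrite inE xs orbT.
  have := sm v; rewrite !inE eqxx orbT => /(_ isT).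
  rewrite /= /pat321; lia.
have -> : occw pat321 ([:: u, v, z & s] ++ m :: t) =
    (pat321 u v z + occw pat321 ([:: v, z & s] ++ m :: t))%N by [].
rewrite IH; last by move=> x xs; apply: sm; rewrite inE xs orbT.
by rewrite /=; lia.
Qed.

(** The last step climbs to [m] if [t] is empty, descends from [m] if [t] has one letter, and
    otherwise lies inside [t]. *)
Lemma ends_asc_cat_max s m t :
  {in s, forall x, (x < m)%N} -> {in t, forall x, (x < m)%N} ->
  ends_asc (s ++ m :: t) = (t == [::]) && (s != [::]) || ends_asc t.
Proof.
move=> sm tm; elim: s sm => [_|u s IH sm].
  case: t tm => [|a [|b t]] //= tm.
  have := tm a (mem_head _ _); lia.
case: s IH sm => [_ sm|v s IH sm].
  have := sm u (mem_head _ _).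
  case: t tm => [|a [|b t]] /= tm um //.
  by have := tm a (mem_head _ _); lia.
transitivity (ends_asc ((v :: s) ++ m :: t)); first by case: (s).
by rewrite IH // => x xs; apply: sm; rewrite inE xs orbT.
Qed.

Lemma begins_desc_cat_max s m t :
  {in s, forall x, (x < m)%N} -> {in t, forall x, (x < m)%N} ->
  begins_desc (s ++ m :: t) = (s == [::]) && (t != [::]) || begins_desc s.
Proof.
case: s => [|u [|v s]] //= sm tm.
  by case: t tm => [|a t] //= tm; rewrite tm // mem_head.
by have := sm u (mem_head _ _); lia.
Qed.

(** * From permutations to words *)

Definition perm_word n (s : 'S_n) : seq nat := [seq val (s i) | i <- enum 'I_n].

Lemma size_perm_word n (s : 'S_n) : size (perm_word s) = n.
Proof. by rewrite size_map size_enum_ord. Qed.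

Lemma nth_perm_word n (s : 'S_n) (i : 'I_n) : nth 0%N (perm_word s) i = s i.
Proof. by rewrite (nth_map i) ?size_enum_ord // nth_ord_enum. Qed.

Lemma perm_word_inj n : injective (@perm_word n).
Proof.
move=> s s' e; apply/permP => i; apply: val_inj.
by rewrite /= -!nth_perm_word e.
Qed.

Lemma perm_words n :
  perm_eq [seq perm_word s | s <- enum {perm 'I_n}] (permutations (iota 0 n)).
Proof.
have us : uniq [seq perm_word s | s <- enum {perm 'I_n}].
  by rewrite (map_inj_uniq (@perm_word_inj n)) enum_uniq.
have sub : {subset [seq perm_word s | s <- enum {perm 'I_n}]
            <= permutations (iota 0 n)}.
  move=> _ /mapP[s _ ->]; rewrite mem_permutations; apply/perm_eq_iotaP; split.
  - suff /map_inj_uniq -> : injective (fun i : 'I_n => val (s i)).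
      exact: enum_uniq.
    by move=> i j /val_inj/perm_inj.
  - exact: size_perm_word.
  - by move=> _ /mapP[i _ ->]; apply: ltn_ord.
(* Both lists have n! distinct entries, so the inclusion is an equality. *)
have [|_ e] := uniq_min_size us sub.
  rewrite size_map -cardE card_Sn size_permutations ?iota_uniq //.
  by rewrite size_iota.
by apply: uniq_perm => //; apply: permutations_uniq.
Qed.

Lemma av132P w :
  reflect (forall i j k, (i < j)%N -> (j < k)%N -> (k < size w)%N ->
             ~~ (nth 0 w i < nth 0 w k < nth 0 w j)%N)
          (av132 w).
Proof.
elim: w => [|x w IH] /=; first by apply: ReflectT.
apply: (iffP andP) => [[/(pairwiseP 0%N) pw /IH av] i j k|H].
  case: i j k => [|i] [|j] [|k] //= ij jk kw; last exact: av.
  apply: pw => //; exact: (@ltn_trans k j (size w) jk kw).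
split; first by apply/(pairwiseP 0%N) => j k jw kw jk; apply: (H 0%N j.+1 k.+1).
by apply/IH => i j k ij jk kw; apply: (H i.+1 j.+1 k.+1).
Qed.

Lemma av132_perm_word n (s : 'S_n) : av132 (perm_word s) = avoids132 s.
Proof.
apply/av132P/idP => [H|H i j k ij jk kn].
  apply/negP => /existsP[a /existsP[b /existsP[c /and4P[ab bc ac cb]]]].
  have := H a b c ab bc; rewrite size_perm_word ltn_ord => /(_ isT).
  by rewrite !nth_perm_word ac cb.
move: kn; rewrite size_perm_word => kn.
have jn := ltn_trans jk kn; have {}ni := ltn_trans ij jn.
apply: contraNN H => /andP[ik kj].
apply/existsP; exists (Ordinal ni); apply/existsP; exists (Ordinal jn).
apply/existsP; exists (Ordinal kn); rewrite -!nth_perm_word /=.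
by rewrite ij jk ik kj.
Qed.

(** The guard [i.+2 < size w] discards the windows running past the end, where [nth] would return
    its default 0. *)
Lemma occw_sum tau w :
  occw tau w = (\sum_(0 <= i < size w) ((i.+2 < size w) &&
     tau (nth 0 w i) (nth 0 w i.+1) (nth 0 w i.+2)))%N.
Proof.
elim: w => [|u w IH]; first by rewrite big_geq.
rewrite big_nat_recl //= IH; congr (_ + _)%N.
by case: w {IH} => [|v [|z w]].
Qed.

Lemma occ_perm_word tau n (s : 'S_n) : occ tau s = occw tau (perm_word s).
Proof.
rewrite occw_sum size_perm_word big_mkord /occ -sum1dep_card big_mkcond /=.
apply: eq_bigr => i _.
suff -> : occurs_at tau s i = (i.+2 < n)%N && tau (nth 0%N (perm_word s) i)
    (nth 0%N (perm_word s) i.+1) (nth 0%N (perm_word s) i.+2) by case: (_ && _).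
apply/existsP/andP => [[j /existsP[k /and3P[/eqP <- /eqP <- t]]]|[kn t]].
  by rewrite !nth_perm_word.
exists (Ordinal (ltnW kn)); apply/existsP; exists (Ordinal kn).
by rewrite -!nth_perm_word /= !eqxx.
Qed.

(** * Generating functions of weighted avoiding words *)

Definition wgf (h : seq nat -> {poly int}) : fps {poly int} :=
  Fps (fun n => \sum_(w <- av_words n) h w).

Lemma F_wgf tau : F_ tau = wgf (fun w => 'X^(occw tau w)).
Proof.
apply/fpsP => n; apply/polyP => r; rewrite coef_F_ /= coef_sum.
rewrite big_filter -(perm_big _ (perm_words n)) big_map big_enum_cond /=.
under eq_bigl => s do rewrite av132_perm_word.
under eq_bigr => s _ do rewrite coefXn -occ_perm_word.
rewrite /f_ cardsE -sum1_card (big_morph _ PoszD (erefl _)) big_mkcondr /=.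
by apply: eq_bigr => s _; rewrite eq_sym; case: eqP.
Qed.

Lemma fps_coefD (R : zmodType) (f g : fps R) n :
  fps_coef (f + g) n = fps_coef f n + fps_coef g n.
Proof. by []. Qed.

Lemma coef_fpsX_mul (f : fps {poly int}) n :
  fps_coef (fpsX _ * f) n = if n is m.+1 then fps_coef f m else 0.
Proof.
rewrite [LHS]/=; case: n => [|m]; first by rewrite big_ord1 mul0r.
rewrite big_ord_recl big_ord_recl /= mul0r add0r mul1r subSS subn0.
by rewrite big1 ?addr0 // => i _; rewrite mul0r.
Qed.

(** Summing over the sizes of the two factors gives Cauchy products, and [fpsX] accounts for the
    maximum. Two product terms are allowed because a glued word can be marked in two ways. *)
Lemma wgf_glue h h1 h2 h3 h4 :
  (forall k l s t, s \in av_words k -> t \in av_words l ->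
     h (glue s t) = h1 s * h2 t + h3 s * h4 t) ->
  wgf h = fpsC (h [::]) + fpsX _ * (wgf h1 * wgf h2 + wgf h3 * wgf h4).
Proof.
move=> hE; apply/fpsP => -[|n].
  by rewrite fps_coefD coef_fpsX_mul /= addr0 big_cons big_nil addr0.
rewrite fps_coefD coef_fpsX_mul /= add0r.
rewrite (perm_big _ (av_wordsS n)) big_flatten big_map -/(index_iota 0 n.+1).
rewrite big_mkord -big_split /=; apply: eq_bigr => k _.
rewrite big_allpairs_dep !mulr_suml -big_split /=; apply: eq_big_seq => s sk.
rewrite !mulr_sumr -big_split /=; apply: eq_big_seq => t tk.
exact: hE sk tk.
Qed.

Lemma wgf_add h1 h2 : wgf (fun w => h1 w + h2 w) = wgf h1 + wgf h2.
Proof. by apply/fpsP => n /=; rewrite big_split. Qed.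

Lemma wgf0 : wgf (fun=> 0) = 0.
Proof. by apply/fpsP => n /=; rewrite big1. Qed.

Lemma fpsC_mul (c : {poly int}) f : fpsC c * f = Fps (fun n => c * fps_coef f n).
Proof.
apply/fpsP => n /=; rewrite big_ord_recl /= subn0 big1 ?addr0 // => i _.
by rewrite mul0r.
Qed.

Lemma wgf_scale c h : wgf (fun w => c * h w) = fpsC c * wgf h.
Proof. by apply/fpsP => n; rewrite fpsC_mul /= mulr_sumr. Qed.

Lemma wgf_nil : wgf (fun w => (w == [::])%:R) = 1.
Proof.
apply/fpsP => -[|n] /=; first by rewrite big_cons big_nil addr0.
rewrite big_seq big1 // => w /size_av_words; by case: w.
Qed.

Lemma wgf_cons h : h [::] = 1 -> wgf (fun w => h w * (w != [::])%:R) = wgf h - 1.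
Proof.
move=> h0; apply/eqP; rewrite eq_sym subr_eq -wgf_nil -wgf_add.
apply/eqP; congr wgf; apply: boolp.funext => -[|u w] /=.
  by rewrite mulr0 add0r.
by rewrite mulr1 addr0.
Qed.

(** * The functional system and its quadratic equation *)

(** The first equation makes [F] the inverse of [1 - x * G]. Multiplying the second by [F] therefore
    solves it for [A] without division, as [F - 1 - x * F]. *)
Lemma marked_quadratic (R : comNzRingType) (x y F G A : R) :
  F = 1 + x * (G * F) -> A = x * (G * A + (G - 1)) -> G = F + (y - 1) * A ->
  x * (x + y - x * y) * F ^+ 2 = (1 + x * y - x) * F - 1.
Proof.
move=> eF eA eG.
have xGF : x * G * F = F - 1 by rewrite [in RHS]eF; ring.
have A1 : A - x * G * A = x * (G - 1) by rewrite [in X in X - _]eA; ring.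
have AF : A = F - 1 - x * F.
  have -> : A = A * (F - x * G * F) by rewrite xGF; ring.
  have -> : A * (F - x * G * F) = F * (A - x * G * A) by ring.
  by rewrite A1 -xGF; ring.
have eG' : G = F + (y - 1) * (F - 1 - x * F) by rewrite eG AF.
have -> : x * (x + y - x * y) * F ^+ 2 =
    x * (F + (y - 1) * (F - 1 - x * F)) * F + x * (y - 1) * F by ring.
by rewrite -eG' xGF; ring.
Qed.

(** Products of series commute, so the order in which the factors are glued does not affect the
    equation. *)
Lemma wgf_glue_flip (b : bool) h h1 h2 h3 h4 :
  (forall k l s t, s \in av_words k -> t \in av_words l ->
     h (if b then glue t s else glue s t) = h1 s * h2 t + h3 s * h4 t) ->
  wgf h = fpsC (h [::]) + fpsX _ * (wgf h1 * wgf h2 + wgf h3 * wgf h4).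
Proof.
case: b => hE; last exact: wgf_glue.
rewrite [wgf h1 * _]mulrC [wgf h3 * _]mulrC; apply: wgf_glue => k l s t sk tl.
by rewrite (hE l k) // [h2 s * _]mulrC [h4 s * _]mulrC.
Qed.

(* For 123 the letters before the maximum create the extra occurrence (when they
   end with an ascent), for 321 the letters after it (when they begin with a
   descent); the flag [b] exchanges the two sides. *)
Lemma F_quadratic (b : bool) (tau : pattern3) (e : pred (seq nat)) :
  let gl s t := if b then glue t s else glue s t in
  (forall k l s t, s \in av_words k -> t \in av_words l ->
     occw tau (gl s t) = (occw tau s + occw tau t + e s)%N) ->
  (forall k l s t, s \in av_words k -> t \in av_words l ->
     e (gl s t) = (t == [::]) && (s != [::]) || e t) ->
  e [::] = false ->
  let x : fps {poly int} := fpsX {poly int} in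
  let y : fps {poly int} := fpsC 'X in
  x * (x + y - x * y) * F_ tau ^+ 2 = (1 + x * y - x) * F_ tau - 1.
Proof.
move=> gl occ_gl e_gl e0 x y; rewrite F_wgf.
(* [f] weighs plain words, [a] marked ones only, and [g] also counts the occurrence that the mark of
   [s] creates when [s] is glued. *)
pose f w : {poly int} := 'X^(occw tau w).
pose a w : {poly int} := (e w)%:R * f w.
pose g w : {poly int} := 'X^(occw tau w + e w).
have g0 : g [::] = 1 by rewrite /g e0.
apply: (@marked_quadratic _ x y _ (wgf g) (wgf a)).
- rewrite [LHS](@wgf_glue_flip b f g f (fun=> 0) (fun=> 0)) ?wgf0 ?mulr0 ?addr0 //.
  move=> k l s t sk tl; rewrite /f (occ_gl k l) // /g /= addr0 -exprD.
  by rewrite addnAC.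
(* Either [t] is marked, giving [G A], or [t] is empty and [s] is not, giving [G - 1]. The cases are
   disjoint because the empty word is unmarked. *)
- rewrite [LHS](@wgf_glue_flip b a g a (fun s => g s * (s != [::])%:R)
    (fun t => (t == [::])%:R)).
    rewrite wgf_nil wgf_cons // mulr1 /a e0 mul0r.
    by have -> : fpsC 0 = 0 :> fps {poly int}; [apply/fpsP => -[] | rewrite add0r].
  move=> k l s t sk tl; rewrite /a (e_gl k l) // /f (occ_gl k l) // addnAC exprD.
  rewrite -/(g s); case: t tl => [|u t] tl; last by rewrite /=; ring.
  by rewrite /= e0; case: (s != [::]) => /=; ring.
(* The relation for [G] holds word by word: [y ^ e = 1 + (y - 1) e] for [e] equal to 0 or 1. *)
have -> : y - 1 = fpsC ('X - 1) by apply/fpsP => -[|n] //=; rewrite subr0.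
rewrite -wgf_scale -wgf_add; congr wgf; apply: boolp.funext => w.
by rewrite /g /a /f; case: (e w); rewrite ?addn1 ?addn0 ?exprS /=; ring.
Qed.

(** * The two patterns and the closed form *)

Lemma bounds_glue k l s t : s \in av_words k -> t \in av_words l ->
  {in map (addn (size t)) s, forall x, (x < size s + size t)%N} /\
  {in t, forall x, (x < size s + size t)%N}.
Proof.
move=> /av_words_bound bs /av_words_bound bt.
split=> [_ /mapP[x /bs xs ->]|x /bt xt]; first by rewrite addnC ltn_add2r.
exact: ltn_addl.
Qed.

Lemma F_123_quadratic :
  let x : fps {poly int} := fpsX {poly int} in
  let y : fps {poly int} := fpsC 'X in
  x * (x + y - x * y) * F_ pat123 ^+ 2 = (1 + x * y - x) * F_ pat123 - 1.
Proof.
apply: (@F_quadratic false pat123 ends_asc) => // k l s t sk tl;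
  have [bs bt] := bounds_glue sk tl.
  rewrite occ123_cat_max // ends_asc_addn occw_addn // => a b c.
  by rewrite /pat123 !ltn_add2l.
by rewrite ends_asc_cat_max //; case: (s).
Qed.

Lemma F_321_quadratic :
  let x : fps {poly int} := fpsX {poly int} in
  let y : fps {poly int} := fpsC 'X in
  x * (x + y - x * y) * F_ pat321 ^+ 2 = (1 + x * y - x) * F_ pat321 - 1.
Proof.
(* With the flag set the glued word is [glue t s]: the factor [s], whose mark creates the
   occurrence, follows the maximum. *)
apply: (@F_quadratic true pat321 begins_desc) => // k l s t sk tl;
  have [bt bs] := bounds_glue tl sk.
  rewrite occ321_cat_max // occw_addn => [|a b c]; first by congr addn; apply: addnC.
  by rewrite /pat321 !ltn_add2l.
by rewrite begins_desc_cat_max // begins_desc_addn; case: (t).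
Qed.

(* The quotient is taken in the field of fractions of Z[y][[x]]: the
   denominator is not invertible in Z[y][[x]] itself. *)
Theorem theorem3p1 :
  let x : fps {poly int} := fpsX {poly int} in
  let y : fps {poly int} := fpsC 'X in
  exists S : fps {poly int},
    [/\ is_fps_sqrt (1 - 2 * x - 3 * x ^+ 2 - x * y * (2 - 2 * x - x * y)) S,
        F_ pat123 = F_ pat321
      & (F_ pat321)%:F =
          (1 + x * y - x - S)%:F / (2 * x * (x + y - x * y))%:F :> {fraction (fps {poly int})}].
Proof.
move=> x y; set D := (X in is_fps_sqrt X).
(* The closed form solved for its square root. *)
pose root F : fps {poly int} := 1 + x * y - x - 2 * x * (x + y - x * y) * F.
have rootP F : x * (x + y - x * y) * F ^+ 2 = (1 + x * y - x) * F - 1 ->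
    is_fps_sqrt D (root F).
  move=> eF; split.
    have -> : root F = 1 + x * (y - 1 - 2 * (x + y - x * y) * F).
      by rewrite /root; ring.
    by rewrite fps_coefD coef_fpsX_mul /= addr0.
  (* Completing the square: the last bracket equals -1 by the quadratic equation, which leaves the
     discriminant [D]. *)
  have -> : root F ^+ 2 = (1 + x * y - x) ^+ 2 + 4 * x * (x + y - x * y) *
      (x * (x + y - x * y) * F ^+ 2 - (1 + x * y - x) * F).
    by rewrite /root; ring.
  by rewrite eF /D; ring.
have nz2 : (2 : {poly int}) != 0 by rewrite -polyC_natr polyC_eq0.
have nz : 2 * x * (x + y - x * y) != 0.
  (* Each factor has a nonzero coefficient: 2 in degree 0, 1 in degree 1, and y in degree 0,
     respectively. *)
  rewrite !mulf_neq0 //; apply/eqP => /fpsP.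
  - by move/(_ 0%N) => /= /eqP; apply/negP.
  - by move/(_ 1%N) => /= /eqP; rewrite oner_eq0.
  move/(_ 0%N); rewrite /= big_ord1 /= mul0r subr0 add0r => /eqP.
  by rewrite polyX_eq0.
exists (root (F_ pat321)); split.
- exact: rootP F_321_quadratic.
(* [root] is injective as [nz] allows cancellation, and both series have the same root by
   uniqueness. *)
- apply: (mulfI nz); apply: oppr_inj; apply: (addrI (1 + x * y - x)).
  exact: is_fps_sqrt_uniq nz2 (rootP _ F_123_quadratic) (rootP _ F_321_quadratic).
have -> : 1 + x * y - x - root (F_ pat321) =
    F_ pat321 * (2 * x * (x + y - x * y)) by rewrite /root; ring.
by rewrite tofracM mulfK // tofrac_eq0.
Qed.
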